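(* Let $q=p^m$ with $p$ prime and let $(k,q)$ be a semiprimitive pair. Then $\Gamma(k,q)$ is Ramanujan if and only if either $k=2$ (the classical Paley graph, $q\equiv1\pmod4$), or $m$ is even and $(k,p,m)$ satisfies one of: (a) $k=3$, $p=2$, $m\ge4$; (b) $k=3$, $p\ne2$, $p\equiv2\pmod3$, $m\ge2$; (c) $k=4$, $p=3$, $m\ge4$; (d) $k=4$, $p\ne3$, $p\equiv3\pmod4$, $m\ge2$; (e) $k=5$, $p=2$, $m\ge8$, $4\mid m$; (f) $k=5$, $p\ne2$, $p\equiv2,3\pmod5$, $m\ge4$, $4\mid m$; (g) $k=5$, $p\equiv4\pmod5$, $m\ge2$. Moreover, $\bar\Gamma(k,q)$ is Ramanujan for every semiprimitive pair $(k,q)$.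
   Context: Let $p$ be prime, $q=p^m$, $k\mid q-1$, $R_k=\{x^k:x\in\mathbb F_q^*\}$. $\Gamma(k,q)$ is the Cayley graph on $\mathbb F_q$ with $u\to v$ an edge iff $v-u\in R_k$; $\bar\Gamma(k,q)$ is the Cayley graph on $\mathbb F_q$ with connection set $\mathbb F_q^*\setminus R_k$. A pair $(k,q)$ is a semiprimitive pair if either $k=2$ and $q\equiv1\pmod4$, or $k>2$, $k\mid p^t+1$ for some $t\mid\frac m2$, and $k\ne p^{m/2}+1$. A connected $N$-regular graph $\Gamma$ is Ramanujan if $\max\{|\lambda|:\lambda\text{ eigenvalue of }\Gamma,\ |\lambda|\ne N\}\le 2\sqrt{N-1}$. *)

(* Defs.v *)
From HB Require Import structures.
From mathcomp Require Import all_boot all_order all_algebra all_field.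
Set Implicit Arguments. Unset Strict Implicit. Unset Printing Implicit Defensive.
Import Order.TTheory GRing.Theory Num.Theory.
Local Open Scope ring_scope.

Definition Rk (F : finFieldType) (k : nat) : {set F} :=
  [set x ^+ k | x in [set y : F | y != 0]].

Definition Rkbar (F : finFieldType) (k : nat) : {set F} :=
  [set y : F | y != 0] :\: Rk F k.

Definition cayley (F : finFieldType) (S : {set F}) : rel F :=
  fun u v => (v - u) \in S.

Definition PGamma (F : finFieldType) (k : nat) : rel F := cayley (Rk F k).
Definition PGammabar (F : finFieldType) (k : nat) : rel F := cayley (Rkbar F k).

Definition adjmx (T : finType) (e : rel T) : 'M[algC]_#|T| :=
  \matrix_(i, j) (e (enum_val i) (enum_val j))%:R.

Definition graph_connected (T : finType) (e : rel T) : Prop :=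
  forall u v : T, connect e u v.

Definition regular (T : finType) (e : rel T) (N : nat) : Prop :=
  forall u : T, #|[set v | e u v]|%N = N.

Definition ramanujan (T : finType) (e : rel T) : Prop :=
  graph_connected e /\
  exists N : nat, (0 < N)%N /\ regular e N /\
    forall lam : algC, eigenvalue (adjmx e) lam ->
      `|lam| != N%:R -> `|lam| <= 2%:R * sqrtC (N.-1)%:R.

Definition semiprimitive (k p m : nat) : Prop :=
  (k = 2 /\ p ^ m = 1 %[mod 4])%N \/
  ((2 < k)%N /\ ~~ odd m /\
   (exists t : nat, (0 < t)%N /\ (t %| m./2)%N /\ (k %| p ^ t + 1)%N) /\
   k <> (p ^ m./2 + 1)%N).

Definition ramanujan_cases (k p m : nat) : Prop :=
  ([/\ k = 3, p = 2 & 4 <= m]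
   \/ [/\ k = 3, p <> 2, p = 2 %[mod 3] & 2 <= m]
   \/ [/\ k = 4, p = 3 & 4 <= m]
   \/ [/\ k = 4, p <> 3, p = 3 %[mod 4] & 2 <= m]
   \/ [/\ k = 5, p = 2, 8 <= m & 4 %| m]
   \/ [/\ k = 5, p <> 2, (p = 2 %[mod 5] \/ p = 3 %[mod 5]),
         4 <= m & 4 %| m]
   \/ [/\ k = 5, p = 4 %[mod 5] & 2 <= m])%N.

Arguments Rk F k : clear implicits.
Arguments Rkbar F k : clear implicits.
Arguments PGamma F k : clear implicits.
Arguments PGammabar F k : clear implicits.

(* Main.v *)
Require Import Defs.
From HB Require Import structures.
From mathcomp Require Import all_boot all_order all_algebra all_field.
From mathcomp Require Import cyclic zify ring lra.

(** The adjacency matrix of a Cayley graph on [F] is diagonalized by the additive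
characters, so its spectrum consists of the character sums over the connection
set.  For a semiprimitive pair put [r = p ^ t] and [K = r + 1], so that [k]
divides [K].  The map [x |-> a * x ^ K] is a Hermitian form, whence the square
of the Gauss sum of order [K] is [q] times the size of the radical of the form,
which is [1] or [r ^ 2]; the sign of the Gauss sum is then determined modulo
[K].  Averaging over the [k]-th powers yields the periods of order [k], which
are the integers [c] and [c - 1 - k * c], where [1 + k * c = (- r) ^ s] is a
signed square root of [q], and the Ramanujan bound becomes an inequality between
integers. *)

Set Implicit Arguments. Unset Strict Implicit. Unset Printing Implicit Defensive.
Import Order.TTheory GRing.Theory Num.Theory.
Local Open Scope ring_scope.

(** * Additive characters and the spectrum of a Cayley graph on [F] *)

Section CayleySpectrum.

Variables (F : finFieldType) (psi : F -> algC).
Hypothesis psiD : {morph psi : x y / x + y >-> x * y}.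
Hypothesis psi0 : psi 0 = 1.
Hypothesis psi_nontrivial : exists x, psi x != 1.

Definition period (S : {set F}) (a : F) : algC := \sum_(s in S) psi (a * s).

Lemma char_orthogonality a : \sum_x psi (a * x) = ((a == 0) * #|F|)%:R.
Proof.
have [->|a0] := eqVneq a 0.
  by rewrite mul1n -sum1_card natr_sum; apply: eq_bigr => x _; rewrite mul0r psi0.
rewrite mul0n; have [y py] := psi_nontrivial.
apply/eqP; have /eqP := erefl (\sum_x psi (a * x)).
rewrite {1}(reindex_inj (addrI (a^-1 * y))) /=.
under eq_bigr do rewrite mulrDr mulVKf // psiD.
rewrite -mulr_sumr -subr_eq0 -{2}[\sum_x _]mul1r -mulrBl mulf_eq0 subr_eq0.
by rewrite (negPf py).
Qed.

Lemma char_sum_delta (u w : F) :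
  \sum_a psi (a * (u - w)) = ((u == w) * #|F|)%:R.
Proof.
rewrite -subr_eq0 -char_orthogonality.
by apply: eq_bigr => a _; rewrite mulrC.
Qed.

Lemma psiN x : psi x * psi (- x) = 1.
Proof. by rewrite -psiD subrr psi0. Qed.

Lemma fourier_inversion (f : F -> algC) u :
  \sum_a (\sum_x f x * psi (a * x)) * psi (- (a * u)) = #|F|%:R * f u.
Proof.
under eq_bigr do rewrite mulr_suml.
rewrite exchange_big (bigD1 u) //= [X in _ + X]big1 ?addr0 => [|x xu].
  under eq_bigr do rewrite -mulrA psiN mulr1.
  by rewrite sumr_const -[f u *+ _]mulr_natl.
under eq_bigr do rewrite -mulrA -psiD -mulrN -mulrDr.
by rewrite -mulr_sumr char_sum_delta (negPf xu) mul0n mulr0.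
Qed.

Variable S : {set F}.

Lemma period0 : period S 0 = #|S|%:R.
Proof.
by rewrite /period -sum1_card natr_sum; apply: eq_bigr => x _; rewrite mul0r psi0.
Qed.

Lemma card_F_neq0 : #|F|%:R != 0 :> algC.
Proof. by rewrite pnatr_eq0 -lt0n; apply/card_gt0P; exists 0. Qed.

(** The Fourier transform turns the eigenvector equation into [(period S a - lam) * fh a = 0] for
    all [a], and by inversion some [fh a] is nonzero. Conversely, the eigenvectors are rows, so the
    matrix sums over [w - s]; this is why the witness is [psi (- (a * x))]. *)
Lemma eigenvalue_cayley lam :
  eigenvalue (adjmx (cayley S)) lam <-> exists a, lam = period S a.
Proof.
have sum_rank (G : 'I_#|F| -> algC) : \sum_i G i = \sum_x G (enum_rank x).
  by rewrite (reindex enum_rank) //; apply: onW_bij; exact: enum_rank_bij.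
split.
  case/eigenvalueP => v vA v0; pose f x := v 0 (enum_rank x).
  have fS w : \sum_(s in S) f (w - s) = lam * f w.
    have := congr1 (fun M : 'rV_#|F| => M 0 (enum_rank w)) vA.
    rewrite !mxE sum_rank -/(f w) => <-.
    rewrite big_mkcond /= (reindex_inj (subrI w)) /=.
    apply: eq_bigr => x _; rewrite !mxE !enum_rankK /cayley subKr.
    by case: ifP; rewrite ?mulr1 ?mulr0.
  pose fh a := \sum_x f x * psi (a * x).
  have fhE a : (period S a - lam) * fh a = 0.
    rewrite mulrBl; apply/eqP; rewrite subr_eq0; apply/eqP.
    rewrite [RHS]mulr_sumr.
    under [RHS]eq_bigr do rewrite mulrA -fS mulr_suml.
    rewrite exchange_big mulr_suml; apply: eq_bigr => s _ /=.
    rewrite [RHS](reindex_inj (addIr s)) mulr_sumr; apply: eq_bigr => x _.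
    by rewrite addrK mulrDr psiD mulrCA [psi (a * s) * _]mulrC.
  have [a a0|fh0] := pickP (fun a => fh a != 0).
    exists a; have /eqP := fhE a.
    by rewrite mulf_eq0 (negPf a0) orbF subr_eq0 => /eqP.
  case/negP: v0; apply/eqP/rowP => j; rewrite mxE.
  have := fourier_inversion f (enum_val j); rewrite big1 => [|a _].
    move/esym/eqP; rewrite mulf_eq0 (negPf card_F_neq0) /f enum_valK.
    by move/eqP.
  by have /negbFE/eqP := fh0 a; rewrite /fh => ->; rewrite mul0r.
case=> a ->; apply/eigenvalueP.
exists (\row_j psi (- (a * enum_val j))); last first.
  apply/eqP => /rowP/(_ (enum_rank 0)); rewrite !mxE enum_rankK mulr0 oppr0 psi0.
  by move/eqP; rewrite oner_eq0.
apply/rowP => j; rewrite !mxE sum_rank.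
under eq_bigr do rewrite !mxE !enum_rankK /cayley.
rewrite (reindex_inj (subrI (enum_val j))) /= mulr_suml [RHS]big_mkcond.
apply: eq_bigr => x _; rewrite subKr; case: ifP; rewrite ?mulr0 // mulr1 => _.
by rewrite -psiD mulrBr opprB.
Qed.

(** Let [C] be the set reachable from 0. Invariance of [C] under translation by [S] multiplies its
    transform at [a] by [psi (a * s)] without changing it. A nonzero value would thus force
    [psi (a * s) = 1] on all of [S]. The transform is therefore supported at 0, and the indicator of
    [C] is constant. *)
Lemma connected_cayley :
  (forall a, a != 0 -> period S a != #|S|%:R) -> graph_connected (cayley S).
Proof.
move=> perN.
have tr u v w : connect (cayley S) u v -> connect (cayley S) (u + w) (v + w).
  case/connectP => s; elim: s u => [|x s IHs] u /=; first by move=> _ ->.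
  case/andP=> Su ps vE; apply: (connect_trans _ (IHs x ps vE)).
  by apply: connect1; rewrite /cayley opprD addrACA subrr addr0.
pose C := [set v | connect (cayley S) 0 v].
(* Translation by [s] sends [C] into itself; finiteness makes this an equality. *)
have CS s : s \in S -> (fun c => c + s) @: C = C.
  move=> Ss; apply/eqP; rewrite eqEcard card_imset ?leqnn ?andbT; last exact: addIr.
  apply/subsetP => _ /imsetP[c + ->]; rewrite !inE => cC.
  by apply: connect_trans cC (connect1 _); rewrite /cayley addrAC subrr add0r.
have C0 a : a != 0 -> \sum_(c in C) psi (a * c) = 0.
  move=> a0; apply/eqP; have := perN a a0; apply: contraNT => Ca.
  rewrite /period -sum1_card natr_sum; apply/eqP; apply: eq_bigr => s Ss.
  apply: (mulIf Ca); rewrite mul1r -[in RHS](CS s Ss).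
  rewrite big_imset /=; last by move=> x y _ _; apply: addIr.
  by rewrite mulr_sumr; apply: eq_bigr => c _; rewrite mulrDr psiD mulrC.
have inC v : v \in C.
  have := fourier_inversion (fun x => (x \in C)%:R) v.
  rewrite (bigD1 0) //= [X in _ + X]big1 ?addr0 => [|a a0]; last first.
    rewrite (_ : \sum_x _ = 0) ?mul0r // -[RHS](C0 a a0) [RHS]big_mkcond.
    by apply: eq_bigr => x _; case: ifP; rewrite ?mul1r ?mul0r.
  rewrite mul0r oppr0 psi0 mulr1; case: (v \in C) => //.
  rewrite mulr0 => /eqP; rewrite psumr_eq0 => [/allP/(_ 0)|x _]; last first.
    by rewrite mul0r psi0 mulr1.
  rewrite mem_index_enum => /(_ isT) /=.
  by rewrite mulr0 psi0 mulr1 inE connect0 oner_eq0.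
move=> u v; have := inC (v - u); rewrite inE => /(tr _ _ u).
by rewrite add0r subrK.
Qed.

Lemma regular_cayley : regular (cayley S) #|S|.
Proof.
move=> u; rewrite -[RHS](card_imset _ (addrI u)); apply: eq_card => v.
rewrite inE /cayley; apply/idP/imsetP => [Sv|[s Ss ->]].
  by exists (v - u) => //; rewrite addrC subrK.
by rewrite addrAC subrr add0r.
Qed.

Lemma ramanujan_cayley :
    (0 < #|S|)%N ->
    (forall a, a != 0 -> period S a != #|S|%:R /\
       `|period S a| ^+ 2 <= (4 * (#|S|.-1))%:R) ->
  ramanujan (cayley S).
Proof.
move=> S0 bnd; split; first by apply: connected_cayley => a /bnd[].
exists #|S|; split=> //; split; first exact: regular_cayley.
move=> _ /eigenvalue_cayley[a ->]; have [->|/bnd[_ le4]] := eqVneq a 0.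
  by rewrite period0 normr_nat eqxx.
move=> _; rewrite -(@ler_pXn2r _ 2) ?nnegrE ?normr_ge0 ?mulr_ge0 ?ler0n ?sqrtC_ge0 //.
by rewrite exprMn sqrtCK -natrX -natrM.
Qed.

Lemma not_ramanujan_cayley a :
    `|period S a| != #|S|%:R -> (4 * (#|S|.-1))%:R < `|period S a| ^+ 2 ->
  ~ ramanujan (cayley S).
Proof.
move=> neN lt4 [_ [N [N0 [regN /(_ (period S a))]]]].
have -> : N = #|S| by rewrite -(regN 0) regular_cayley.
move/(_ (proj2 (eigenvalue_cayley _) (ex_intro _ a erefl)) neN).
rewrite -(@ler_pXn2r _ 2) ?nnegrE ?normr_ge0 ?mulr_ge0 ?ler0n ?sqrtC_ge0 //.
by rewrite exprMn sqrtCK -natrX -natrM lt_geF.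
Qed.

End CayleySpectrum.

(** * The absolute trace and a nontrivial additive character *)

Section AbsoluteTrace.

Variables (F : finFieldType) (p : nat).
Hypothesis charFp : p \in [pchar F].

(** For [n = m] this is the trace to the prime field; a free [n] lets the sum be cut into blocks. *)
Definition abs_trace n (z : F) : F := \sum_(i < n) z ^+ (p ^ i).

Lemma pchar_natX n : [pchar F].-nat (p ^ n)%N.
Proof.
by rewrite (eq_pnat _ (pcharf_eq charFp)) pnatX pnat_id // (pcharf_prime charFp).
Qed.

Lemma frobD n : {morph (fun x : F => x ^+ (p ^ n)) : x y / x + y}.
Proof.
by move=> x y; apply: exprDn_pchar (pchar_natX n).
Qed.

Lemma frobN n : {morph (fun x : F => x ^+ (p ^ n)) : x / - x}.
Proof.
by move=> x; apply: exprNn_pchar (pchar_natX n).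
Qed.

Lemma frob_inj n : injective (fun x : F => x ^+ (p ^ n)).
Proof.
move=> x y /eqP; rewrite -subr_eq0 -frobN -frobD expf_eq0 => /andP[_].
by rewrite subr_eq0 => /eqP.
Qed.

Lemma abs_trace0 n : abs_trace n 0 = 0.
Proof.
rewrite /abs_trace big1 // => i _.
by rewrite expr0n gtn_eqF // expn_gt0 prime_gt0 // (pcharf_prime charFp).
Qed.

Lemma abs_traceD n : {morph abs_trace n : x y / x + y}.
Proof. by move=> x y; rewrite -big_split; apply: eq_bigr => i _; apply: frobD. Qed.

Lemma abs_trace_add n n' z :
  abs_trace (n + n') z = abs_trace n z + abs_trace n' (z ^+ (p ^ n)).
Proof.
rewrite /abs_trace big_split_ord; congr (_ + _).
by apply: eq_bigr => i _; rewrite -exprM expnD.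
Qed.

(** Consecutive blocks of length [t] are opposite, and there is an even number of them. *)
Lemma abs_trace_antiinvariant t s z :
  z ^+ (p ^ t) = - z -> abs_trace (t * s.*2) z = 0.
Proof.
move=> zt; elim: s => [|s IHs]; first by rewrite muln0 /abs_trace big_ord0.
have zt2 : z ^+ (p ^ (t + t)) = z by rewrite expnD exprM zt frobN zt opprK.
have zts n : z ^+ (p ^ (t * n.*2)) = z.
  elim: n => [|n IHn]; first by rewrite muln0.
  by rewrite doubleS !mulnS addnA expnD exprM zt2.
rewrite doubleS !mulnS addnA addnC abs_trace_add IHs zts add0r abs_trace_add zt.
by rewrite -abs_traceD subrr abs_trace0.
Qed.

Variable m : nat.
Hypotheses (m0 : (0 < m)%N) (cardF : #|F| = (p ^ m)%N).

Let p_pr : prime p. Proof. exact: pcharf_prime charFp. Qed.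

Lemma abs_trace_frob z : abs_trace m (z ^+ p) = abs_trace m z.
Proof.
rewrite /abs_trace; case: m m0 cardF => // n _ cF.
rewrite big_ord_recr [RHS]big_ord_recl /= addrC expr1; congr (_ + _).
  by rewrite -exprM -expnS -cF expf_card.
by apply: eq_bigr => i _; rewrite -exprM -expnS.
Qed.

Lemma abs_trace_prime z : exists i : 'I_p, i%:R == abs_trace m z.
Proof.
set y := abs_trace m z.
have yp : y ^+ p = y.
  rewrite -[RHS]abs_trace_frob /y -[in LHS](expn1 p).
  rewrite (big_morph _ (frobD 1) (_ : 0 ^+ _ = 0)) ?expr0n ?expn1 ?gtn_eqF ?prime_gt0 //.
  by apply: eq_bigr => i _; rewrite -!exprM mulnC.
apply/existsP; apply: contraTT isT => /existsPn ny.
(* The [p] multiples of 1 are roots of ['X^p - 'X], so a Frobenius-fixed [y] outside them would be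
   one root too many. *)
pose P : {poly F} := 'X^p - 'X.
have sP : size P = p.+1.
  by rewrite size_polyDl size_polyXn // size_polyN size_polyX ltnS prime_gt1.
pose rs := y :: [seq (i : nat)%:R | i : 'I_p].
have : (size rs < size P)%N.
  apply: max_poly_roots; first by rewrite -size_poly_gt0 sP.
    rewrite /= rootE !hornerE yp subrr eqxx; apply/allP => _ /imageP[i _ ->].
    rewrite rootE !hornerE -(pFrobenius_autE charFp) rmorph_nat.
    by rewrite subrr.
  rewrite /= map_inj_uniq ?enum_uniq ?andbT.
    by apply/imageP => -[i _ yE]; move: (ny i); rewrite -yE eqxx.
  move=> i j; have : (i <= j)%N || (j <= i)%N by apply: leq_total.
  wlog ij : i j / (i <= j)%N => [W /orP[]le ijE|_ ijE].
  - by apply: W => //; rewrite le.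
  - by symmetry; apply: W => //; rewrite le.
  apply/val_inj/eqP; rewrite eqn_leq ij -subn_eq0 /=.
  have : (j - i)%:R == 0 :> F by rewrite natrB // ijE subrr.
  rewrite -(dvdn_pcharf charFp) => pdvd; apply: contraTT pdvd.
  rewrite -lt0n => /gtnNdvd->//.
  exact: leq_ltn_trans (leq_subr i j) (ltn_ord j).
by rewrite sP /= size_map -cardE card_ord ltnn.
Qed.

(** The character is [w] raised to the trace, lifted to a natural number, with [w] a primitive
    [p]-th root of unity. It is nontrivial because the trace is a polynomial of degree [p ^ m.-1]
    and cannot vanish at all [p ^ m] points. *)
Lemma additive_character_exists : exists psi : F -> algC,
  [/\ {morph psi : x y / x + y >-> x * y}, exists x, psi x != 1,
      forall x, psi (x ^+ p) = psi x, forall x, psi x \in Aint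
    & forall x, abs_trace m x = 0 -> psi x = 1].
Proof.
have [w w_prim] := C_prim_root_exists (prime_gt0 p_pr).
pose ex z : nat := val (xchoose (abs_trace_prime z)).
have exE z : (ex z)%:R = abs_trace m z.
  exact/eqP/(xchooseP (abs_trace_prime z)).
have wE i z : i%:R = abs_trace m z -> w ^+ ex z = w ^+ i.
  rewrite -exE => izE; apply/eqP; rewrite (eq_prim_root_expr w_prim).
  have [le|/ltnW le] := leqP i (ex z); last rewrite eq_sym.
    by rewrite eqn_mod_dvd // (dvdn_pcharf charFp) natrB // izE exE subrr.
  by rewrite eqn_mod_dvd // (dvdn_pcharf charFp) natrB // izE exE subrr.
exists (fun z => w ^+ ex z); split.
- by move=> x y; rewrite -exprD; apply: wE; rewrite natrD !exE abs_traceD.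
- apply/existsP; apply: contraTT isT => /existsPn psi1.
  have tr0 z : abs_trace m z = 0.
    have := psi1 z; rewrite negbK -(prim_order_dvd w_prim) (dvdn_pcharf charFp).
    by rewrite exE => /eqP.
  pose P : {poly F} := \sum_(i < m) 'X^(p ^ i).
  have sP : size P = (p ^ m.-1).+1.
    rewrite /P; case: m m0 => // n _; rewrite big_ord_recr /= addrC.
    rewrite size_polyDl size_polyXn // ltnS.
    apply: (leq_trans (size_sum _ _ _)); apply/bigmax_leqP => i _.
    by rewrite size_polyXn ltn_exp2l // prime_gt1.
  have := @max_poly_roots F P (enum F); rewrite -cardE cardF sP enum_uniq.
  rewrite -size_poly_gt0 sP => /(_ isT) H.
  have : (p ^ m < (p ^ m.-1).+1)%N.
    apply: H => //; apply/allP => x _; rewrite rootE horner_sum.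
    by rewrite -[X in _ == X](tr0 x); apply/eqP/eq_bigr => i _; rewrite hornerXn.
  by rewrite ltnS leq_exp2l ?prime_gt1 // -ltnS prednK // ltnn.
- by move=> x; apply: wE; rewrite exE abs_trace_frob.
- by move=> x; apply/rpredX/(Aint_prim_root w_prim).
- by move=> x tx; apply: (wE 0%N); rewrite tx.
Qed.

End AbsoluteTrace.

(** * Power residues in the cyclic group of nonzero elements *)

Section PowerResidues.

Variable F : finFieldType.
Local Notation n := #|F|.-1.

Lemma card_pred_gt0 : (0 < n)%N.
Proof. by case: #|F| (finNzRing_gt1 F) => [|[]]. Qed.


Lemma expf_card_pred (x : F) : x != 0 -> x ^+ n = 1.
Proof.
move=> x0; apply: (mulfI x0).
by rewrite mulr1 -exprS prednK ?expf_card // ltnW // finNzRing_gt1.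
Qed.

Lemma generator_exists : exists g : F, n.-primitive_root g.
Proof.
have /hasP[g _ gP] : has n.-primitive_root (enum (predC1 (0 : F))).
  apply: has_prim_root; rewrite ?card_pred_gt0 ?enum_uniq -?cardE ?cardC1 //.
  apply/allP => x; rewrite mem_enum inE => x0.
  by apply/unity_rootP/expf_card_pred.
by exists g.
Qed.

Variable d : nat.
Hypothesis d_dvd : (d %| n)%N.

Let d_gt0 : (0 < d)%N.
Proof. by apply: dvdn_gt0 d_dvd; exact: card_pred_gt0. Qed.

(** Euler's criterion: for a generator [g], the power [n %/ d] of [g ^+ i] is 1 exactly when [d]
    divides [i]. *)
Lemma mem_Rk (x : F) : (x \in Rk F d) = (x != 0) && (x ^+ (n %/ d) == 1).
Proof.
apply/imsetP/andP => [[y]|[x0 /eqP xd]].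
  rewrite inE => y0 ->; rewrite expf_neq0 //.
  by rewrite -exprM mulnC divnK // expf_card_pred.
have [g g_prim] := generator_exists.
have [i xE] := prim_rootP g_prim (expf_card_pred x0).
move: xd; rewrite xE -exprM => /eqP; rewrite -(prim_order_dvd g_prim).
rewrite -[X in (X %| _)%N](divnK d_dvd) [(i * _)%N]mulnC dvdn_pmul2l; last first.
  by rewrite divn_gt0 // dvdn_leq // card_pred_gt0.
move=> di; exists (g ^+ (i %/ d)); last by rewrite -exprM divnK.
by rewrite inE expf_eq0 (prim_root_eq0 g_prim) gtn_eqF ?card_pred_gt0 ?andbF.
Qed.

Lemma card_roots_of_unity : #|[set x : F | x ^+ d == 1]| = d.
Proof.
have [g g_prim] := generator_exists.
have [z z_prim] : exists z : F, d.-primitive_root z.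
  by exists (g ^+ (n %/ d)); apply: dvdn_prim_root.
rewrite -[RHS]card_ord -(card_imset _ (f := fun i : 'I_d => z ^+ i)); last first.
  move=> i j /eqP; rewrite (eq_prim_root_expr z_prim) !modn_small // => /eqP.
  exact: val_inj.
apply: eq_card => x; rewrite [LHS]inE; apply/eqP/imsetP => [/(prim_rootP z_prim)[i ->]|].
  by exists i.
by case=> i _ ->; rewrite -exprM mulnC exprM (prim_expr_order z_prim) expr1n.
Qed.

Lemma card_power_fiber (y : F) : y != 0 ->
  #|[set x : F | x ^+ d == y ^+ d]| = d.
Proof.
move=> y0; rewrite -[RHS]card_roots_of_unity -[RHS](card_imset _ (mulfI y0)).
apply: eq_card => x; rewrite [LHS]inE; apply/eqP/imsetP => [xy|[z]].
  exists (y^-1 * x); last by rewrite mulVKf.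
  by rewrite inE exprMn xy exprVn mulVf // expf_neq0.
by rewrite inE => /eqP z1 ->; rewrite exprMn z1 mulr1.
Qed.

Lemma sum_powers (G : F -> algC) :
  \sum_(x | x != 0) G (x ^+ d) = d%:R * \sum_(r in Rk F d) G r.
Proof.
rewrite (partition_big (fun x => x ^+ d) (mem (Rk F d))) /= => [|x x0]; last first.
  by apply/imsetP; exists x; rewrite ?inE.
rewrite mulr_sumr; apply: eq_bigr => r /imsetP[y]; rewrite inE => y0 ->.
rewrite mulr_natl -[X in _ *+ X](card_power_fiber y0) -sumr_const.
apply: eq_big => [x|x /andP[_ /eqP->] //].
rewrite inE; have [->|] := eqVneq x 0; last by rewrite andTb.
by rewrite expr0n gtn_eqF //= eq_sym expf_eq0 d_gt0 (negPf y0).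
Qed.

Lemma card_Rk : (#|Rk F d| * d = n)%N.
Proof.
have := sum_powers (fun => 1); rewrite !sumr_const -natrM cardC1 => /eqP.
by rewrite eqr_nat mulnC => /eqP.
Qed.

Lemma Rk_neq0 x : x \in Rk F d -> x != 0.
Proof. by rewrite mem_Rk => /andP[]. Qed.

Lemma RkM : {in Rk F d &, forall x y, x * y \in Rk F d}.
Proof.
move=> x y; rewrite !mem_Rk => /andP[x0 /eqP x1] /andP[y0 /eqP y1].
by rewrite mulf_neq0 // exprMn x1 y1 mulr1 eqxx.
Qed.

Lemma RkV : {in Rk F d, forall x, x^-1 \in Rk F d}.
Proof.
move=> x; rewrite !mem_Rk => /andP[x0 /eqP x1].
by rewrite invr_eq0 x0 exprVn x1 invr1 /=.
Qed.

Lemma card_Rkbar : (#|Rkbar F d| = n - #|Rk F d|)%N.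
Proof.
rewrite /Rkbar cardsD; congr (_ - _)%N.
  by rewrite cardsE cardC1.
apply: eq_card => x; rewrite !inE.
by case: (boolP (x \in Rk F d)) => [/Rk_neq0->|]; rewrite ?andbF.
Qed.

End PowerResidues.

(** * Gauss sums as power sums, and the quadratic case *)

Section GaussSums.

Variables (F : finFieldType) (psi : F -> algC).
Hypothesis psiD : {morph psi : x y / x + y >-> x * y}.
Hypothesis psi0 : psi 0 = 1.
Hypothesis psi_nontrivial : exists x, psi x != 1.

(** The sum runs over all of [F]; its term at 0 is the 1 in [1 + d * period]. *)
Definition gauss_sum (d : nat) (a : F) : algC := \sum_x psi (a * x ^+ d).

Lemma gauss_sum_period d a : (d %| #|F|.-1)%N ->
  gauss_sum d a = 1 + d%:R * period psi (Rk F d) a.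
Proof.
move=> d_dvd; have d0 : (0 < d)%N by apply: dvdn_gt0 d_dvd; apply: card_pred_gt0.
rewrite /gauss_sum (bigD1 0) //= expr0n gtn_eqF // mulr0 psi0; congr (_ + _).
exact: (sum_powers d_dvd (fun y => psi (a * y))).
Qed.

Lemma period_Rkbar d a : (d %| #|F|.-1)%N -> a != 0 ->
  period psi (Rkbar F d) a = - 1 - period psi (Rk F d) a.
Proof.
move=> d_dvd a0; apply/eqP; rewrite eq_sym subr_eq addrC eq_sym; apply/eqP.
have := char_orthogonality psiD psi0 psi_nontrivial a.
rewrite (negPf a0) mul0n (bigD1 0) //= mulr0 psi0 => /eqP.
rewrite addrC addr_eq0 => /eqP<-; rewrite (bigID (mem (Rk F d))) /=.
congr (_ + _); apply: eq_bigl => x.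
  by case: (boolP (x \in Rk F d)) => [/(Rk_neq0 d_dvd)->|]; rewrite ?andbF.
by rewrite !inE andbC.
Qed.

(* Writing a square as S(a) S(-a) avoids complex conjugation. *)
Lemma gauss_sum_sqr d a : -1 \in Rk F d ->
  gauss_sum d a ^+ 2 = \sum_y \sum_x psi (a * (x + y) ^+ d - a * x ^+ d).
Proof.
case/imsetP => u; rewrite inE => u0 uN1.
have SN : gauss_sum d a = \sum_x psi (- (a * x ^+ d)).
  rewrite /gauss_sum (reindex_inj (mulfI u0)); apply: eq_bigr => x _.
  by rewrite exprMn -uN1 mulN1r mulrN.
rewrite expr2 {2}SN mulr_sumr [RHS]exchange_big; apply: eq_bigr => x _.
rewrite mulr_suml (reindex_inj (addrI x)) /=.
by apply: eq_bigr => y _; rewrite -psiD.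
Qed.

(** For fixed [y] the difference of the two squares is affine in [x] with slope [2 * a * y], so only
    [y = 0] survives. *)
Lemma quadratic_gauss_sum_sqr a :
  a != 0 -> 2%:R != 0 :> F -> -1 \in Rk F 2 -> gauss_sum 2 a ^+ 2 = #|F|%:R.
Proof.
move=> a0 two0 N1; rewrite gauss_sum_sqr // (bigD1 0) //=.
under eq_bigr do rewrite addr0 subrr psi0.
rewrite sumr_const cardT -cardE big1 ?addr0 // => y y0.
under eq_bigr => x _.
  rewrite (_ : _ - _ = a * y ^+ 2 + (2%:R * a * y) * x); last by ring.
  rewrite psiD; over.
rewrite -mulr_sumr (char_orthogonality psiD psi0 psi_nontrivial).
by rewrite !mulf_eq0 (negPf two0) (negPf a0) (negPf y0) mulr0.
Qed.

End GaussSums.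

(** * Gauss sums of order [r + 1] and semiprimitive periods *)

Section SemiprimitivePeriods.

Variables (F : finFieldType) (p t s : nat).
Hypotheses (p_prime : prime p) (t_gt0 : (0 < t)%N).
Hypothesis cardF : #|F| = (p ^ (t * s.*2))%N.
Variable psi : F -> algC.
Hypothesis psiD : {morph psi : x y / x + y >-> x * y}.
Hypothesis psi0 : psi 0 = 1.
Hypothesis psi_nontrivial : exists x, psi x != 1.
Hypothesis psi_frob : forall x, psi (x ^+ p) = psi x.
Hypothesis psi_Aint : forall x, psi x \in Aint.
Hypothesis psi_trace : forall x, abs_trace p (t * s.*2) x = 0 -> psi x = 1.

Local Notation r := (p ^ t)%N.
Local Notation K := (p ^ t).+1.
Local Notation n := #|F|.-1.

Let charFp : p \in [pchar F]. Proof. exact: card_finPcharP cardF p_prime. Qed.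

Let r_gt1 : (1 < r)%N.
Proof. by rewrite -(exp1n t) ltn_exp2r // prime_gt1. Qed.

Lemma dvd_card_minus1 : exists M, n = (r.-1 * K * M)%N.
Proof.
have /dvdnP[M nE] : (r.-1 * K %| n)%N.
  have -> : (r.-1 * K = (r ^ 2).-1)%N.
    by move: r_gt1; case: (p ^ t)%N => // x _; rewrite -mulnn; nia.
  by rewrite cardF expnM -muln2 mulnC expnM dvdn_pred_predX.
by exists M; rewrite nE mulnC.
Qed.

Lemma signN1 e : (odd p -> ~~ odd e) -> (-1) ^+ e = 1 :> F.
Proof.
have [p2 _|p_odd ev] := even_prime p_prime; last first.
  by rewrite -signr_odd (negbTE (ev p_odd)).
have -> : -1 = 1 :> F by apply: oppr_pchar2; rewrite -p2.
by rewrite expr1n.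
Qed.

Lemma K_dvd : (K %| n)%N.
Proof. by have [M ->] := dvd_card_minus1; rewrite mulnAC dvdn_mull. Qed.

Lemma r1_dvd : (r.-1 %| n)%N.
Proof. by have [M ->] := dvd_card_minus1; rewrite -mulnA dvdn_mulr. Qed.

Lemma neg1_Rk_K : -1 \in Rk F K.
Proof.
rewrite mem_Rk ?K_dvd // oppr_eq0 oner_neq0 /=; apply/eqP/signN1 => p_odd.
have [M ->] := dvd_card_minus1; rewrite mulnAC mulnK // oddM.
by rewrite -subn1 oddB ?expn_gt0 ?prime_gt0 // oddX p_odd orbT.
Qed.

(** Such a [z] solves [z ^+ r.-1 = -1], which Euler's criterion allows. It will mark the coset of
    [K]-th powers on which the Hermitian form degenerates. *)
Lemma antiinvariant_exists : exists2 z : F, z != 0 & z ^+ r = - z.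
Proof.
have : -1 \in Rk F r.-1.
  rewrite mem_Rk ?r1_dvd // oppr_eq0 oner_neq0 /=; apply/eqP/signN1 => p_odd.
  have [M ->] := dvd_card_minus1; rewrite -mulnA mulKn; last first.
    by rewrite -ltnS prednK ?r_gt1 // ltnW.
  by rewrite oddM /= oddX p_odd orbT.
case/imsetP => z; rewrite inE => z0 zN; exists z => //.
by rewrite -(prednK (ltnW r_gt1)) exprS -zN mulrN1.
Qed.

Lemma psi_frobX i x : psi (x ^+ (p ^ i)) = psi x.
Proof. by elim: i => [|i IHi]; rewrite ?expr1 // expnSr exprM psi_frob. Qed.

(** This is the radical of the form [a * x ^+ K]: for [y != 0] the condition amounts to
    [a * y + a ^+ r * y ^+ (r * r) = 0]. Stated as anti-invariance, it makes the trace of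
    [a * y ^+ K] vanish. *)
Definition anti_set (a : F) : {set F} :=
  [set y | (a * y ^+ K) ^+ r == - (a * y ^+ K)].

(** Since [x ^+ r] is additive, the difference of the two values of the form is [a * y ^+ K] plus
    two terms in [x]. As [psi] is Frobenius invariant, these merge into one term linear in [x ^+ r]
    with coefficient [c]. The inner sum is [#|F|] or 0 according to whether [c = 0], and then
    [psi (a * y ^+ K) = 1]. *)
Lemma gauss_sum_anti_set a : a != 0 ->
  gauss_sum psi K a ^+ 2 = (#|F| * #|anti_set a|)%:R.
Proof.
move=> a0; rewrite gauss_sum_sqr ?neg1_Rk_K // natrM mulrC mulr_natl.
rewrite -sumr_const [RHS]big_mkcond; apply: eq_bigr => y _.
pose c := a * y + a ^+ r * y ^+ (r * r).
have frobM : bijective (fun x : F => x ^+ r).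
  exact/injF_bij/(frob_inj charFp).
have -> : \sum_x psi (a * (x + y) ^+ K - a * x ^+ K) =
    psi (a * y ^+ K) * \sum_x psi (c * x).
  rewrite [in RHS](reindex (fun x : F => x ^+ r)); last exact: onW_bij.
  rewrite mulr_sumr; apply: eq_bigr => x _.
  have -> : a * (x + y) ^+ K - a * x ^+ K =
      a * y ^+ K + (a * y * x ^+ r + a * y ^+ r * x).
    by rewrite !exprSr (frobD charFp); ring.
  rewrite psiD psiD -[psi (a * y ^+ r * x)](psi_frobX t) -!psiD; congr psi.
  by rewrite !exprMn -exprM /c; ring.
rewrite (char_orthogonality psiD psi0 psi_nontrivial) inE.
have -> : ((a * y ^+ K) ^+ r == - (a * y ^+ K)) = (c == 0).
  rewrite -addr_eq0.
  have -> : (a * y ^+ K) ^+ r + a * y ^+ K = c * y ^+ r.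
    by rewrite exprMn -exprM mulSn exprD exprSr /c; ring.
  rewrite mulf_eq0 expf_eq0 expn_gt0 prime_gt0 //=.
  have [y0|] := eqVneq y 0; last by rewrite orbF.
  rewrite /c y0 expr0n gtn_eqF ?muln_gt0 ?expn_gt0 ?prime_gt0 //.
  by rewrite !mulr0 addr0 eqxx.
have [c0|_] := eqVneq c 0; last by rewrite mul0n mulr0.
rewrite mul1n psi_trace ?mul1r //.
apply: (abs_trace_antiinvariant charFp).
apply/eqP; rewrite -addr_eq0.
have -> : (a * y ^+ K) ^+ r + a * y ^+ K = c * y ^+ r.
  by rewrite exprMn -exprM mulSn exprD exprSr /c; ring.
by rewrite c0 mul0r.
Qed.

(** A nonzero [y] belongs to the set iff [a ^+ r.-1 * y ^+ (r.-1 * K) = -1]. One solution [y1] thus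
    yields a full fibre of the power [r ^ 2 - 1], to which 0 is added. *)
Lemma card_anti_set a y1 : a != 0 -> y1 != 0 -> y1 \in anti_set a ->
  #|anti_set a| = (r ^ 2)%N.
Proof.
move=> a0 y10; rewrite inE => /eqP ay1.
have dvd : (r.-1 * K %| n)%N.
  by have [M ->] := dvd_card_minus1; rewrite dvdn_mulr.
have -> : anti_set a = 0 |: [set y | y ^+ (r.-1 * K) == y1 ^+ (r.-1 * K)].
  apply/setP => y; rewrite !inE; have [->|y0] := eqVneq y 0.
    by rewrite expr0n mulr0 oppr0 expr0n gtn_eqF ?expn_gt0 ?prime_gt0 ?eqxx.
  have e z : z != 0 -> ((a * z ^+ K) ^+ r == - (a * z ^+ K)) =
      (a ^+ r.-1 * z ^+ (r.-1 * K) == - 1).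
    move=> z0; have nz : a * z ^+ K != 0 by rewrite mulf_neq0 ?expf_neq0.
    rewrite mulnC exprM -exprMn -[RHS](inj_eq (mulIf nz)) /= mulN1r -exprSr.
    by rewrite prednK // ltnW.
  have /eqP := ay1; rewrite !e // => /eqP <-.
  by rewrite (inj_eq (mulfI _)) ?expf_neq0.
have d0 : (0 < r.-1 * K)%N by rewrite muln_gt0 -ltnS prednK ?r_gt1 // ltnW.
rewrite cardsU1 inE card_power_fiber // expr0n (gtn_eqF d0) eq_sym expf_eq0.
rewrite (negPf y10) andbF /=; move: r_gt1; case: (p ^ t)%N => // x _.
by rewrite -mulnn; nia.
Qed.

Lemma anti_set_trivial a : (forall y, y \in anti_set a -> y = 0) ->
  #|anti_set a| = 1%N.
Proof.
move=> W0; rewrite -(cards1 (0 : F)); congr #|pred_of_set _|; apply/setP => y.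
rewrite in_set1; apply/idP/eqP => [/W0 //|->].
by rewrite inE expr0n mulr0 oppr0 expr0n gtn_eqF ?expn_gt0 ?prime_gt0.
Qed.

(* The sign of the square root is forced by [gauss_sum = 1] modulo [K]
   in the algebraic integers, since [- r = 1] modulo [K] and [K > 2]. *)
Lemma gauss_sum_sign a j :
  gauss_sum psi K a ^+ 2 = ((- r%:R) ^+ j) ^+ 2 ->
  gauss_sum psi K a = (- r%:R) ^+ j.
Proof.
have [c c_int cE] : exists2 c : algC, c \in Aint & (- r%:R) ^+ j = 1 + K%:R * c.
  elim: j => [|j [c c_int IHj]]; first by exists 0; rewrite ?rpred0 // mulr0 addr0.
  exists (- r%:R * c - 1); first by rewrite rpredB ?rpred1 // rpredM ?rpredN ?rpred_nat.
  by rewrite exprS IHj -[K]addn1 natrD; ring.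
move=> /eqP; rewrite eqf_sqr => /orP[/eqP //|/eqP].
rewrite gauss_sum_period ?K_dvd // cE => eqN.
have K0 : K%:R != 0 :> algC by rewrite pnatr_eq0.
have : 2%:R / K%:R = - (period psi (Rk F K) a + c).
  apply: (mulIf K0); rewrite mulfVK // mulNr mulrDl ![_ * K%:R]mulrC.
  apply/eqP; rewrite -subr_eq0 opprK addrCA addrA.
  rewrite (_ : _ + _ + _ = (1 + K%:R * period psi (Rk F K) a) + (1 + K%:R * c));
    last by ring.
  by rewrite eqN addNr.
move=> twoK; have : (2%:R / K%:R : algC) \in Num.int.
  apply: Cint_rat_Aint; first by rewrite rpred_div ?rpred_nat.
  by rewrite twoK rpredN rpredD // rpred_sum.
move/norm_intr_ge1; rewrite mulf_neq0 ?invr_eq0 ?pnatr_eq0 // => /(_ isT).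
rewrite normf_div !normr_nat ler_pdivlMr ?ltr0n // mul1r ler_nat.
by rewrite !ltnS leqNgt r_gt1.
Qed.

Lemma gauss_sum_semiprimitive : exists2 z : F, z != 0 & forall a, a != 0 ->
  gauss_sum psi K a = (- r%:R) ^+ (s + (a / z \in Rk F K)).
Proof.
have [z z0 zr] := antiinvariant_exists; exists z => // a a0.
apply: gauss_sum_sign; rewrite gauss_sum_anti_set //.
have qE : #|F| = ((r ^ s) ^ 2)%N by rewrite cardF -!expnM -muln2 mulnA.
have sq j : ((r ^ j) ^ 2)%:R = ((- r%:R) ^+ j) ^+ 2 :> algC.
  by rewrite !natrX exprAC [RHS]exprAC sqrrN.
have [az|naz] := boolP (a / z \in Rk F K).
  (* If [a / z = u ^+ K], then [u^-1] is in the radical, since [a * u^-1 ^+ K = z]. *)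
  have /imsetP[u] := az; rewrite inE => u0 azE.
  rewrite (@card_anti_set a u^-1) ?invr_eq0 //.
    by rewrite qE -expnMn -expnSr addn1 sq.
  by rewrite inE exprVn -azE invf_div mulrCA mulfV // mulr1 zr.
rewrite anti_set_trivial ?muln1 ?addn0.
  by rewrite qE sq.
move=> y; rewrite inE => /eqP ay; apply: contraNeq naz => y0.
have w0 : a * y ^+ K / z != 0 by rewrite !mulf_neq0 ?expf_neq0 ?invr_eq0.
(* A quotient of two anti-invariant elements is fixed by [x ^+ r], and nonzero fixed elements are
   [K]-th powers because [r.-1] divides [n %/ K]. *)
have : a * y ^+ K / z \in Rk F K.
  rewrite mem_Rk ?K_dvd // w0 /=; have [M ->] := dvd_card_minus1.
  rewrite mulnAC mulnK // exprM.
  suff -> : (a * y ^+ K / z) ^+ r.-1 = 1 by rewrite expr1n.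
  apply: (mulIf w0); rewrite mul1r -exprSr prednK ?(ltnW r_gt1) //.
  by rewrite exprMn ay exprVn zr invrN mulrNN.
have : y^-1 ^+ K \in Rk F K by apply/imset_f; rewrite inE invr_eq0.
move=> yR /(RkM K_dvd)/(_ yR); rewrite exprVn.
by rewrite mulrAC mulfK ?expf_neq0.
Qed.

Variable k : nat.
Hypothesis k_dvd : (k %| K)%N.

(** As [k] divides [K], multiplication by [y ^+ K] permutes [Rk F k], so each of the [#|Rk F k| * k]
    nonzero [y] contributes the same period. *)
Lemma sum_gauss_sum a :
  \sum_(x in Rk F k) gauss_sum psi K (a * x) =
    #|Rk F k|%:R * (1 + k%:R * period psi (Rk F k) a).
Proof.
have kn : (k %| n)%N := dvdn_trans k_dvd K_dvd.
rewrite exchange_big (bigD1 0) //=.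
under eq_bigr do rewrite expr0n mulr0 psi0.
rewrite sumr_const mulrDr mulr1; congr (_ + _).
rewrite mulrA -natrM card_Rk // -(cardC1 (0 : F)) mulr_natl -sumr_const.
apply: eq_big => [x|x x0]; first by rewrite inE.
have xR : x ^+ K \in Rk F k.
  case/dvdnP: k_dvd => c ->; rewrite exprM.
  by apply/imset_f; rewrite inE expf_neq0.
rewrite /period [RHS](reindex_onto (fun y => x ^+ K * y) (fun y => x ^- K * y)).
  apply: eq_big => [y|y _]; last by rewrite -mulrA [y * _]mulrC.
  rewrite mulKf ?expf_neq0 // eqxx andbT; apply/idP/idP => [|yR]; first exact: RkM.
  rewrite -[y](mulKf (expf_neq0 K x0)); apply: RkM => //.
  exact: RkV.
by move=> y _; rewrite mulVKf ?expf_neq0.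
Qed.

Lemma period_semiprimitive : exists2 z : F, z != 0 & forall a, a != 0 ->
  1 + k%:R * period psi (Rk F k) a =
    (- r%:R) ^+ s * (1 - k%:R * (a / z \in Rk F k)%:R).
Proof.
have kn : (k %| n)%N := dvdn_trans k_dvd K_dvd.
have [z z0 gE] := gauss_sum_semiprimitive; exists z => // a a0.
have Rk0 : #|Rk F k|%:R != 0 :> algC.
  rewrite pnatr_eq0 -lt0n; have := card_pred_gt0 F.
  by rewrite -(card_Rk kn) muln_gt0 => /andP[].
have RkKk x : x \in Rk F K -> x \in Rk F k.
  case/imsetP => y; rewrite inE => y0 ->; case/dvdnP: k_dvd => c ->; rewrite exprM.
  by apply/imset_f; rewrite inE expf_neq0.
apply: (mulfI Rk0); rewrite -sum_gauss_sum.
(* Since [Rk F K] lies in [Rk F k], the shifted coset meets [Rk F K] either in nothing or in all of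
   it. The factor [K] avoids a division and later combines with [- r = 1 - K]. *)
have cnt : (\sum_(x in Rk F k) (a * x / z \in Rk F K) * K =
    #|Rk F k| * k * (a / z \in Rk F k))%N.
  rewrite card_Rk // -(card_Rk K_dvd) -big_distrl /= mulnAC; congr (_ * _)%N.
  have [azk|azk] := boolP (a / z \in Rk F k); last first.
    rewrite muln0 big1 // => x xR; apply/eqP; rewrite eqb0.
    apply: contra azk => /RkKk axz.
    have := RkM kn axz (RkV kn xR).
    by rewrite mulrAC mulfK // (Rk_neq0 kn).
  have az0 := Rk_neq0 kn azk.
  rewrite muln1 -[RHS]sum1_card -big_mkcondr /=.
  rewrite [LHS](reindex_onto (fun y => (a / z)^-1 * y) (fun y => a / z * y)).
    apply: eq_bigl => y; rewrite mulVKf // eqxx andbT mulrAC mulVKf //.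
    case: (boolP (y \in Rk F K)) => [/RkKk yk|]; last by rewrite andbF.
    by rewrite andbT RkM // RkV.
  by move=> y _; rewrite mulKf.
have cntC : \sum_(x in Rk F k) (a * x / z \in Rk F K)%:R * K%:R =
    #|Rk F k|%:R * k%:R * (a / z \in Rk F k)%:R :> algC.
  by rewrite -!natrM -cnt natr_sum; apply: eq_bigr => x _; rewrite natrM.
rewrite mulrCA mulrBr mulr1 mulrA -cntC mulrBr mulrC mulr_natl -sumr_const.
rewrite mulr_sumr -sumrB; apply: eq_bigr => x xR.
rewrite gE ?mulf_neq0 ?(Rk_neq0 kn xR) // exprD.
case: (_ \in _); last by rewrite mul0r mulr0 subr0 mulr1.
by rewrite expr1 mul1r -[K]addn1 natrD; ring.
Qed.

End SemiprimitivePeriods.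

(** * Arithmetic of the case list: it describes the semiprimitive pairs with [k <= 5] *)

Lemma ramanujan_cases_le5 (k p m : nat) :
    prime p -> (0 < m)%N -> (2 < k)%N -> semiprimitive k p m ->
  (k <= 5)%N <-> (~~ odd m /\ ramanujan_cases k p m).
Proof.
move=> p_pr m0 k2 [[k2E _]|[_ [m_even [[t [t0 [tm kdvd]]] kN]]]].
  by rewrite k2E in k2.
have m2 : (2 <= m)%N by case: m m0 m_even {tm kN} => [|[|]].
have mE : m = (m./2).*2 by rewrite even_halfK.
have pt_mod d : (p ^ t + 1 = (p %% d) ^ t + 1 %[mod d])%N.
  by rewrite -modnDml -modnXm modnDml.
split=> [k5|[_]]; last first.
  by rewrite /ramanujan_cases; do !case; move=> *; subst k.
split=> //.
have dvd_mod : (k %| (p %% k) ^ t + 1)%N by rewrite /dvdn -pt_mod.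
have pk : (p %% k < k)%N by rewrite ltn_mod ltnW // ltnW.
have /or3P[/eqP kE|/eqP kE|/eqP kE] : [|| k == 3, k == 4 | k == 5]%N by lia.
- subst k; have p2 : (p %% 3 = 2)%N.
    case: (p %% 3)%N pk dvd_mod => [|[|[|//]]] _; rewrite ?exp0n ?exp1n //.
  (* Here [m = 2] would give [k = p ^ m./2 + 1], which is excluded. The same exclusion raises the
     bound on [m] for [k = 4], [p = 3] and for [k = 5], [p = 2]. *)
  have [pE|pN] := p =P 2; [left|right; left]; split => //.
  have : m <> 2 by move=> mE'; apply: kN; rewrite pE mE'.
  by lia.
- subst k; have p3 : (p %% 4 = 3)%N.
    case: (p %% 4)%N pk dvd_mod => [|[|[|[|//]]]] _; rewrite ?exp0n ?exp1n //.
    case: t t0 {tm kdvd pt_mod} => [//|[//|u]] _.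
    by rewrite /dvdn -modnDml !expnS mulnA modnMr.
  do 2!right; have [pE|pN] := p =P 3; [left|right; left]; split => //.
  have : m <> 2 by move=> mE'; apply: kN; rewrite pE mE'.
  by lia.
- subst k; do 4!right.
  have [p4|p4] := eqVneq (p %% 5)%N 4; first by right; right.
  have p23 : (p %% 5 = 2 \/ p %% 5 = 3)%N.
    case: (p %% 5)%N pk dvd_mod p4 => [|[|[|[|[|//]]]]] _; rewrite ?exp0n ?exp1n //.
      by left.
    by right.
  have pow4 h : ((4 ^ h) %% 5 = 1 \/ (4 ^ h) %% 5 = 4)%N.
    elim: h => [|h [] IHh]; first by left.
      by right; rewrite expnS -modnMmr IHh.
    by left; rewrite expnS -modnMmr IHh.
  (* With [p] congruent to 2 or 3 modulo 5, [p ^ 2] is -1, so an odd power of [p] is again 2 or 3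
     and never -1. Hence [t] and [m./2] are even. *)
  have t_even : ~~ odd t.
    apply/negP => t_odd; move: dvd_mod.
    have -> : ((p %% 5) ^ t = p %% 5 * ((p %% 5) ^ 2) ^ t./2)%N.
      by rewrite -expnM mul2n -expnS -[in LHS](odd_double_half t) t_odd.
    rewrite /dvdn -modnDml -modnMmr -modnXm.
    by case: p23 => ->; case: (pow4 t./2) => ->.
  have m4 : (4 %| m)%N.
    rewrite mE -muln2 (dvdn_pmul2r (p := 2) (d := 2)) //.
    by apply: dvdn_trans tm; rewrite dvdn2.
  have [pE|pN] := p =P 2; [left|right; left]; split => //.
    have : m <> 4 by move=> mE'; apply: kN; rewrite pE mE'.
    by case/dvdnP: m4 m0 => c ->; lia.
  by apply: dvdn_leq.
Qed.

(** * Ramanujan criteria in terms of periods *)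

Section FromPeriods.

Variables (F : finFieldType) (psi : F -> algC).
Hypothesis psiD : {morph psi : x y / x + y >-> x * y}.
Hypothesis psi0 : psi 0 = 1.
Hypothesis psi_nontrivial : exists x, psi x != 1.

Lemma ramanujan_int_periods (S : {set F}) (N : int) :
    #|S|%:Z = N -> 0 < N ->
    (forall a, a != 0 -> exists2 z : int, period psi S a = z%:~R &
       z != N /\ z ^+ 2 <= 4 * (N - 1)) ->
  ramanujan (cayley S).
Proof.
move=> SN N0 perS.
have SE : #|S|%:R = N%:~R :> algC by rewrite -SN.
apply: (ramanujan_cayley psiD psi0 psi_nontrivial) => [|a /perS[z -> [zN z4]]].
  by rewrite -ltz_nat SN.
rewrite SE eqr_int zN; split=> //.
have -> : (4 * (#|S|.-1))%:R = (4 * (N - 1))%:~R :> algC.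
  by rewrite -SN -[LHS]/((4 * (#|S|.-1))%N%:Z%:~R); congr _%:~R; lia.
by rewrite -intr_norm -rmorphXn /= ler_int real_normK ?num_real.
Qed.

Lemma not_ramanujan_int_period (S : {set F}) (N z : int) a :
    #|S|%:Z = N -> 0 < N -> period psi S a = z%:~R ->
    z != N -> - z != N -> 4 * (N - 1) < z ^+ 2 ->
  ~ ramanujan (cayley S).
Proof.
move=> SN N0 perE zN zN' z4.
have SE : #|S|%:R = N%:~R :> algC by rewrite -SN.
have S4 : (4 * (#|S|.-1))%:R = (4 * (N - 1))%:~R :> algC.
  by rewrite -SN -[LHS]/((4 * (#|S|.-1))%N%:Z%:~R); congr _%:~R; lia.
apply: (not_ramanujan_cayley psiD psi0 psi_nontrivial (a := a)).
  by rewrite perE SE -intr_norm eqr_int; lia.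
by rewrite perE S4 -intr_norm -rmorphXn /= ltr_int real_normK ?num_real.
Qed.

(** Meant for Paley graphs, whose periods may be irrational. With [X] the square root of
    [2 * #|S| + 1], the inequality [(X + 1) ^+ 2 <= 2 * X ^+ 2 + 2] gives [|e| ^+ 2 <= #|S| + 1],
    which is at most [4 * (#|S| - 1)] once [#|S| >= 2]. *)
Lemma ramanujan_half_density (S : {set F}) :
    (2 <= #|S|)%N ->
    (forall a, a != 0 -> (1 + 2%:R * period psi S a) ^+ 2 = (#|S|.*2.+1)%:R) ->
  ramanujan (cayley S).
Proof.
move=> S2 perS.
apply: (ramanujan_cayley psiD psi0 psi_nontrivial) => [|a /perS]; first exact: ltnW.
move: (period _ _ _) => e eS; split.
  apply/eqP => eE; move/eqP: eS.
  by rewrite eE -natrM -[1 + _]/(1%:R + _) -natrD -natrX eqr_nat; nia.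
have [X [X0 X_sqr le1]] : exists X : algC, [/\ 0 <= X,
    X ^+ 2 = (#|S|.*2.+1)%:R & `|2%:R * e| <= X + 1].
  exists `|1 + 2%:R * e|; split; first exact: normr_ge0.
    by rewrite -normrX eS normr_nat.
  have {1}-> : 2%:R * e = (1 + 2%:R * e) - 1 by ring.
  by rewrite (le_trans (ler_normB _ _)) // normr1.
have amgm : (X + 1) ^+ 2 <= 2%:R * X ^+ 2 + 2%:R.
  rewrite -subr_ge0 (_ : _ - _ = (X - 1) ^+ 2); last by ring.
  by rewrite real_exprn_even_ge0 // rpredB ?rpred1 ?ger0_real.
have le2 : `|2%:R * e| ^+ 2 <= 2%:R * (#|S|.*2.+1)%:R + 2%:R.
  rewrite -X_sqr; apply: le_trans amgm; apply: lerXn2r le1.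
    by rewrite nnegrE normr_ge0.
  by rewrite nnegrE addr_ge0.
rewrite -(ler_pM2l (_ : 0 < 4%:R)) ?ltr0n //.
have -> : 4%:R * `|e| ^+ 2 = `|2%:R * e| ^+ 2 by rewrite normrM exprMn normr_nat -natrX.
by rewrite (le_trans le2) // -!natrM -natrD ler_nat; lia.
Qed.

End FromPeriods.

(** * Integer inequalities between periods and valencies *)

Section IntegerBounds.

Variables k c : int.
Hypothesis k3 : 3 <= k.
(** If [(1 + k * c) ^+ 2 = q], this is [(q - 1) / k], the valency. *)
Local Notation N := (c * (k * c + 2)).

Lemma valency_gt0 : c != 0 -> 0 < N.
Proof. move=> c0; have : c <= -1 \/ 1 <= c by lia. by case; nia. Qed.

Lemma period_le_bound : c <= -2 \/ 1 <= c ->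
  c != N /\ c ^+ 2 <= 4 * (N - 1).
Proof. by case=> hc; split; nia. Qed.

(** Both signs matter: the Ramanujan condition ignores eigenvalues of absolute value [N]. *)
Lemma exceptional_period_neq : c <= -2 \/ 1 <= c ->
  c - 1 - k * c != N /\ - (c - 1 - k * c) != N.
Proof. by case=> hc; split; nia. Qed.

(** Right side minus left side is [(6 * k - k ^ 2 - 1) * c ^ 2 + 2 * (5 - k) * c - 5]. The leading
    coefficient changes sign between [k = 5] and [k = 6], whence the threshold; at [k = 5] the value
    [4 * c ^ 2 - 5] is negative at [c = 1]. *)
Lemma exceptional_period_le_bound : k <= 5 -> c <= -2 \/ 1 <= c ->
  ~ (k = 5 /\ c = 1) -> (c - 1 - k * c) ^+ 2 <= 4 * (N - 1).
Proof.
move=> k5 hc h; have : k = 3 \/ k = 4 \/ k = 5 by lia.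
by case=> [kE|[kE|kE]]; rewrite kE in h *; case: hc => hc; nia.
Qed.

Lemma exceptional_period_gt_bound : 5 < k -> c <= -2 \/ 1 <= c ->
  4 * (N - 1) < (c - 1 - k * c) ^+ 2.
Proof. by move=> k5 [hc|hc]; nia. Qed.

Lemma co_period_le_bound : c <= -2 \/ 1 <= c ->
  - 1 - c != (k - 1) * N /\ (- 1 - c) ^+ 2 <= 4 * ((k - 1) * N - 1).
Proof. by case=> hc; split; nia. Qed.

(** Here the difference has leading coefficient [(k - 1) * (3 * k + 1)], positive for every [k], so
    no threshold appears. *)
Lemma co_exceptional_period_le_bound : c <= -2 \/ 1 <= c ->
  (k - 1) * c != (k - 1) * N /\ ((k - 1) * c) ^+ 2 <= 4 * ((k - 1) * N - 1).
Proof. by case=> hc; split; nia. Qed.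

End IntegerBounds.

(** * The Paley case and the final assembly *)

Lemma paley_ramanujan (F : finFieldType) (p m : nat) :
    prime p -> (0 < m)%N -> #|F| = (p ^ m)%N -> (p ^ m = 1 %[mod 4])%N ->
  ramanujan (PGamma F 2) /\ ramanujan (PGammabar F 2).
Proof.
move=> p_pr m0 cF q1; have charFp := card_finPcharP cF p_pr.
have [psi [psiD psi_nt psi_frob _ psi_tr]] := additive_character_exists charFp m0 cF.
have psi0 : psi 0 = 1 by exact/psi_tr/abs_trace0.
have q4 : (#|F| %% 4 = 1)%N by rewrite cF q1.
have q_gt1 : (1 < #|F|)%N := finNzRing_gt1 F.
have d2 : (2 %| #|F|.-1)%N by lia.
have cR : (#|F| = #|Rk F 2|.*2.+1)%N by have := card_Rk d2; lia.
have cRb : #|Rkbar F 2| = #|Rk F 2| by rewrite (card_Rkbar d2); lia.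
have N2 : (2 <= #|Rk F 2|)%N by lia.
have two0 : 2%:R != 0 :> F.
  rewrite -(dvdn_pcharf charFp) dvdn_prime2 //; apply/eqP => pE.
  by move: q4; rewrite cF pE -(prednK m0) expnS; lia.
have N1 : -1 \in Rk F 2.
  rewrite mem_Rk // oppr_eq0 oner_neq0 /= -signr_odd.
  have /dvdnP[u ->] : (4 %| #|F|.-1)%N by lia.
  by rewrite (_ : (u * 4 %/ 2)%N = (u * 2)%N) ?oddM ?andbF //; lia.
have perE a : a != 0 -> (1 + 2%:R * period psi (Rk F 2) a) ^+ 2 =
    (#|Rk F 2|.*2.+1)%:R.
  by move=> a0; rewrite -gauss_sum_period // quadratic_gauss_sum_sqr // -cR.
split; apply: (ramanujan_half_density psiD psi0 psi_nt); rewrite ?cRb //.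
(* Passing from [e] to [-1 - e] only changes the sign of [1 + 2 * e]. *)
by move=> a a0; rewrite -(perE a a0) period_Rkbar //; ring.
Qed.

Lemma prime_power_neq6 p e : prime p -> (p ^ e <> 6)%N.
Proof.
move=> p_pr pe; have dvd6 r : prime r -> (r %| 6)%N -> r = p.
  by move=> r_pr; rewrite -pe Euclid_dvdX // dvdn_prime2 // => /andP[/eqP].
by have := dvd6 3 isT isT; rewrite -(dvd6 2 isT isT).
Qed.

Theorem theorem4p1 (F : finFieldType) (p m k : nat) :
  prime p -> (0 < m)%N -> #|F| = (p ^ m)%N ->
  (k %| p ^ m - 1)%N ->
  semiprimitive k p m ->
  (ramanujan (PGamma F k) <->
     (k = 2%N \/ (~~ odd m /\ ramanujan_cases k p m)))
  /\ ramanujan (PGammabar F k).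
Proof.
move=> p_pr m0 cF k_dvd semi.
case: (semi) => [[k2 q1]|[k2 [m_even [[t [t0 [tm kdvd]]] kN]]]].
  rewrite k2; have [R Rb] := paley_ramanujan p_pr m0 cF q1.
  by split=> //; split=> // _; left.
have [s m2E] := dvdnP tm.
have mE : m = (t * s.*2)%N by rewrite -(even_halfK m_even) m2E -!muln2; lia.
have s0 : (0 < s)%N by case: s mE {m2E} m0 => // ->; rewrite muln0.
move/(ramanujan_cases_le5 p_pr m0 k2): semi => {m_even tm} le5.
have charFp := card_finPcharP cF p_pr.
have [psi [psiD psi_nt psi_frob psi_int psi_tr]] :=
  additive_character_exists charFp m0 cF.
have psi0 : psi 0 = 1 by exact/psi_tr/abs_trace0.
have kn : (k %| #|F|.-1)%N by rewrite cF -subn1.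
rewrite addn1 in kdvd.
rewrite mE in psi_tr; have cF' := cF; rewrite mE in cF'.
have [z z0 perE] := period_semiprimitive p_pr t0 cF' psiD psi0 psi_nt
  psi_frob psi_int psi_tr kdvd.
have sqrtq_gt1 : (1 < p ^ (t * s))%N.
  by rewrite -(exp1n (t * s)) ltn_exp2r ?prime_gt1 // muln_gt0 t0.
have [c cE] : exists c : int, (- (p ^ t)%N%:Z) ^+ s = 1 + k%:Z * c.
  case/dvdnP: kdvd => d rE; elim: (s) => [|j [c IHj]].
    by exists 0; rewrite mulr0 addr0.
  (* The witness comes from multiplying [1 + k * c] by [- r = 1 - d * k]. *)
  exists (- (p ^ t)%N%:Z * c - d%:Z); rewrite exprS IHj.
  have -> : (p ^ t)%N%:Z = d%:Z * k%:Z - 1 by lia.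
  by ring.
have absE : (p ^ (t * s))%N%:Z = `|1 + k%:Z * c|
  by rewrite -cE normrX normrN ger0_norm // -!natz expnM natrX.
have c0 : c != 0.
  by apply/eqP => c0; move: absE; rewrite c0 mulr0 addr0 normr1; lia.
(* [c = -1] means that the square root of [q] is [k - 1], the excluded case [k = p ^ m./2 + 1]. *)
have cN1 : c != -1.
  apply/eqP => cN1; apply: kN; move: absE; rewrite cN1 mulrN1 m2E mulnC.
  by move: (p ^ _)%N k2 => Q; clear; lia.
have c_gt : c <= -2 \/ 1 <= c by move: c0 cN1; clear; lia.
(* The bound fails at [k = 5], [c = 1], but there [sqrt q] would be [6]. *)
have k51 : ~ (k%:Z = 5 /\ c = 1).
  case=> k5 c1; apply: (@prime_power_neq6 p (t * s) p_pr).
  by move: absE; rewrite k5 c1 => -[].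
have k3 : 3 <= k%:Z by move: k2; clear; lia.
pose N := c * (k%:Z * c + 2).
have N0 : 0 < N by exact: valency_gt0.
have cR : #|Rk F k|%:Z = N.
  apply: (mulIf (_ : k%:Z != 0)); first by move: k2; clear; lia.
  rewrite -PoszM card_Rk // cF' -muln2 mulnA expnM -subn1.
  rewrite -subzn ?expn_gt0 ?prime_gt0 // -mulnn PoszM absE -normrM -expr2.
  by rewrite ger0_norm ?sqr_ge0 // /N; ring.
have cRb : #|Rkbar F k|%:Z = (k%:Z - 1) * N.
  by rewrite (card_Rkbar kn) -(card_Rk kn) -cR; move: #|_| k2 => R; clear; nia.
have k0 : k%:R != 0 :> algC by rewrite pnatr_eq0; lia.
have per a : a != 0 ->
    period psi (Rk F k) a = (if a / z \in Rk F k then c - 1 - k%:Z * c else c)%:~R.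
  move=> /perE E; apply: (mulfI k0); apply: (addrI 1); rewrite {}E.
  have -> : (- (p ^ t)%:R : algC) ^+ s = 1 + k%:R * c%:~R.
    rewrite -[k%:R]/(k%:Z%:~R) -intrM -[1 + _]/(1%:~R + _) -intrD -cE.
    by rewrite [RHS]rmorphXn /= mulrNz.
  by case: ifP => _; rewrite ?rmorphB ?rmorphM /=; ring.
split; last first.
  apply: (ramanujan_int_periods psiD psi0 psi_nt cRb) => [|a a0].
    by rewrite mulr_gt0 //; lia.
  exists (-1 - (if a / z \in Rk F k then c - 1 - k%:Z * c else c)).
    by rewrite period_Rkbar // per // rmorphB.
  case: ifP => _; last exact: co_period_le_bound.
  have -> : -1 - (c - 1 - k%:Z * c) = (k%:Z - 1) * c by ring.
  exact: co_exceptional_period_le_bound.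
have [neN neN'] := exceptional_period_neq k3 c_gt.
split=> [ram|[k2E|/le5 k5]].
- right; apply/le5; rewrite leqNgt; apply/negP => k5; move: ram.
  (* At [a = z] the quotient [a / z] is 1, a [k]-th power, so the exceptional period does occur. *)
  apply: (not_ramanujan_int_period psiD psi0 psi_nt (a := z) cR N0 _ neN neN').
    rewrite per // divff // mem_Rk // oner_neq0 expr1n eqxx //.
  exact: exceptional_period_gt_bound.
- by rewrite k2E in k2.
apply: (ramanujan_int_periods psiD psi0 psi_nt cR N0) => a a0.
exists (if a / z \in Rk F k then c - 1 - k%:Z * c else c); first exact: per.
case: ifP => _; last exact: period_le_bound.
by split=> //; apply: exceptional_period_le_bound.
Qed.
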